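(* Let $p\in\mathbb{R}[x]$ be a univariate real polynomial. Then the following are equivalent: (i) $p$ is convex (as a function $\mathbb{R}\to\mathbb{R}$); (ii) $\operatorname{Tr} p$ is convex, i.e., $p$ is trace-convex; (iii) the noncommutative second directional derivative $p''(x)[h]$ is a sum of hermitian squares and commutators, i.e., there are finitely many $r_j, f_i, g_i\in\mathbb{R}\langle x,h\rangle$ such that $$p''(x)[h]=\sum_j r_j^T r_j+\sum_i (f_ig_i-g_if_i).$$
   Context: $\mathbb{S}_n$ denotes the set of real symmetric $n\times n$ matrices. $\mathbb{R}\langle x,h\rangle$ is the free associative unital $\mathbb{R}$-algebra on two noncommuting variables $x,h$. It carries the $\mathbb{R}$-linear involution $^T$ that reverses words and fixes $x$ and $h$ (so $(fg)^T=g^Tf^T$, $x^T=x$, $h^T=h$). An element $r^Tr$ is a hermitian square; an element $fg-gf$ is a commutator. For a univariate polynomial $p$, the noncommutative second directional derivative (Hessian) is $p''(x)[h]:=\frac{d^2}{dt^2}p(x+th)\big|_{t=0}\in\mathbb{R}\langle x,h\rangle$, where $p(x+th)$ is expanded in $\mathbb{R}\langle x,h\rangle[t]$ with $t$ a commuting variable. Equivalently, it is the part of $2(p(x+h)-p(x))\in\mathbb{R}\langle x,h\rangle$ that is homogeneous of degree two in $h$. $p$ is trace-convex if for every $n\in\mathbb{N}$ and all $X,Y\in\mathbb{S}_n$ one has $\frac12(\operatorname{Tr}p(X)+\operatorname{Tr}p(Y))\ge \operatorname{Tr}p\big(\frac{X+Y}{2}\big)$. *)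

(* Defs.v *)
From mathcomp Require Import all_boot all_order all_algebra.
From mathcomp Require Import classical_sets reals convex.
From mathcomp Require Import finmap monalg.

Set Implicit Arguments.
Unset Strict Implicit.
Unset Printing Implicit Defensive.

Import GRing.Theory.

Local Open Scope classical_set_scope.
Local Open Scope ring_scope.

(* The free algebra R<x,h>: the monoid algebra over R of the free monoid of
   words in two letters, with [false] encoding x and [true] encoding h. *)
Notation free_xh R := {malg R[{fmonom bool}]}.

Definition ncx {R : realType} : free_xh R := << fmu false >>.
Definition nch {R : realType} : free_xh R := << fmu true >>.

Definition involution {R : realType} (f : free_xh R) : free_xh R :=
  \sum_(w <- msupp f) << f@_w *g FMonom (rev w) >>.

(* p(x + t h), an element of R<x,h>[t]; the commuting variable t is the 'X of
   the outer polynomial ring. *)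
Definition nc_line {R : realType} (p : {poly R}) : {poly free_xh R} :=
  (map_poly (fun c : R => (c%:MP : free_xh R)%:P) p).[ncx%:P + nch *: 'X].

Definition nc_hessian {R : realType} (p : {poly R}) : free_xh R :=
  (nc_line p)^`(2).[0].

Definition sum_hermitian_squares_commutators {R : realType}
    (q : free_xh R) : Prop :=
  exists (r : seq (free_xh R)) (fg : seq (free_xh R * free_xh R)),
    q = \sum_(a <- r) involution a * a
        + \sum_(u <- fg) (u.1 * u.2 - u.2 * u.1).

(* The matrix size is n.+1 because [horner_mx] is defined for positive sizes
   only. *)
Definition trace_convex {R : realType} (p : {poly R}) : Prop :=
  forall (n : nat) (X Y : 'M[R]_n.+1), X^T = X -> Y^T = Y ->
    \tr (horner_mx (2^-1 *: (X + Y)) p)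
      <= 2^-1 * (\tr (horner_mx X p) + \tr (horner_mx Y p)).

(* Main.v *)
From HB Require Import structures.
Require Import Defs.
From mathcomp Require Import all_boot all_order all_algebra.
From mathcomp Require Import classical_sets reals convex.
From mathcomp Require Import finmap monalg.
From mathcomp Require Import interval_inference ring lra polyrcf.
From mathcomp Require derive.

Set Implicit Arguments.
Unset Strict Implicit.
Unset Printing Implicit Defensive.

Import Order.TTheory GRing.Theory Num.Theory.
Import normed_module.numFieldNormedType.Exports.

Local Open Scope ring_scope.

(* Both (i) and (ii) give p'' >= 0 on R, so p'' is a sum of squares f ^ 2.
   Modulo commutators the Hessian is D h, where D, the part of p'(x + h) linear
   in h, is obtained from the divided difference
     (p'(s) - p'(t)) / (s - t) = \sum_f \int_0^1 f(t + u (s - t))^2 du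
   by replacing s^a t^b by x^b h x^a. Writing f(t + u (s - t)) as
   \sum_k c_k u^k, the integral becomes \sum_{k,l} c_k c_l / (k + l + 1). If
   C_k is obtained from c_k, then c_k c_l corresponds to C_k^T C_l up to
   commutators (after multiplication by h), and the Hilbert matrix
   1 / (k + l + 1) is a sum of rank one squares; this gives (iii).
   Conversely, (iii) makes the second derivative of t |-> Tr p(X + t H)
   nonnegative, because a trace kills commutators, whence (ii); finally, 1 x 1
   matrices give back p'' >= 0 and hence (i). *)

(** * Univariate polynomials *)

Lemma horner_ge0_right (R : rcfType) (p : {poly R}) (a : R) :
  (forall x, a < x -> 0 <= p.[x]) -> 0 <= p.[a].
Proof.
move=> p_ge0; rewrite leNgt; apply/negP => pa_lt0.
have [|d d_gt0 pP] := @poly_cont _ a p (- p.[a]); first by rewrite oppr_gt0.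
have /pP : `|a + d / 2 - a| < d.
  by rewrite addrC addKr gtr0_norm ?divr_gt0 //; lra.
have := p_ge0 (a + d / 2); rewrite ltrDl divr_gt0 // => /(_ isT) h.
by rewrite ltr_norml; lra.
Qed.

Lemma horner_ge0_left (R : rcfType) (p : {poly R}) (a : R) :
  (forall x, x < a -> 0 <= p.[x]) -> 0 <= p.[a].
Proof.
move=> p_ge0; have := @horner_ge0_right _ (p \Po - 'X) (- a).
rewrite horner_comp !hornerE opprK; apply=> x a_lt_x.
by rewrite horner_comp !hornerE; apply: p_ge0; rewrite ltrNl.
Qed.

(** In [p = r * ('X - a%:P)] the factor [r] has the sign of [x - a] off [a], so by continuity from
    both sides it vanishes at [a] too. The second quotient is nonnegative off [a], hence also at
    [a]. *)
Lemma nneg_poly_root (R : rcfType) (p : {poly R}) (a : R) :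
  (forall x, 0 <= p.[x]) -> root p a ->
  exists2 q, p = ('X - a%:P) ^+ 2 * q & forall x, 0 <= q.[x].
Proof.
move=> p_ge0 /factor_theorem[r pE].
have sgn_r x : 0 <= r.[x] * (x - a) by have := p_ge0 x; rewrite pE !hornerE.
have r_right x : a < x -> 0 <= r.[x].
  by move=> ax; have := sgn_r x; rewrite pmulr_lge0 // subr_gt0.
have r_left x : x < a -> 0 <= (- r).[x].
  move=> xa; have := sgn_r x; rewrite hornerN nmulr_lge0 ?subr_lt0 //.
  by rewrite oppr_ge0.
have ra : root r a.
  apply/rootP/le_anti; rewrite (horner_ge0_right r_right) andbT.
  by rewrite -oppr_ge0 -hornerN horner_ge0_left.
have /factor_theorem[q rE] := ra.
have pE2 : p = ('X - a%:P) ^+ 2 * q by rewrite pE rE; ring.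
have q_neq x : x != a -> 0 <= q.[x].
  move=> xa; have := p_ge0 x; rewrite pE2 !hornerE.
  by rewrite pmulr_rge0 // exprn_even_gt0 //= subr_eq0.
exists q => // x; have [->|/q_neq//] := eqVneq x a.
by apply: horner_ge0_right => y ay; apply: q_neq; rewrite gt_eqF.
Qed.

(** Induction along Horner's scheme, from [|q x + c| >= |q| |x| - |c|]. A nonzero constant [q]
    starts the induction. *)
Lemma poly_coercive (R : realFieldType) (p : {poly R}) : (1 < size p)%N ->
  forall M, exists B, forall x, B <= `|x| -> M <= `|p.[x]|.
Proof.
elim/poly_ind: p => [|q c IHq]; first by rewrite size_poly0.
rewrite size_MXaddC; case: ifP => // _ q_gt0 M.
have low x : `|q.[x]| * `|x| - `|c| <= `|(q * 'X + c%:P).[x]|.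
  by rewrite !hornerE -normrM; have := lerB_normD (q.[x] * x) c.
have [q1|q_gt1] := leqP (size q) 1.
  have qC := size1_polyC q1; set k := q`_0 in qC.
  have k_neq0 : 0 < `|k|.
    by rewrite normr_gt0 -polyC_eq0 -qC -size_poly_gt0; move: q_gt0; case: size.
  exists ((M + `|c|) / `|k|) => x; rewrite ler_pdivrMr // => h.
  apply: le_trans (low x); rewrite qC hornerC; lra.
have [B hB] := IHq q_gt1 (`|M| + `|c|).
exists (Num.max B 1) => x; rewrite ge_max => /andP[/hB h1 h2].
apply: le_trans (low x).
have h3 : `|q.[x]| <= `|q.[x]| * `|x| by rewrite ler_peMr.
have := ler_norm M; lra.
Qed.

Lemma nneg_poly_min (R : realType) (p : {poly R}) : (forall x, 0 <= p.[x]) ->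
  exists a, forall x, p.[a] <= p.[x].
Proof.
move=> p_ge0; have [p1|p_gt1] := leqP (size p) 1.
  by exists 0 => x; rewrite (size1_polyC p1) !hornerC.
have [B hB] := poly_coercive p_gt1 p.[0].
(* [B] may be negative; the bound [|B|] makes the interval contain 0. Outside it, [p] is at least
   [p.[0]], hence at least the minimum over the interval. *)
have [||a _ ha] := @derive.EVT_min R (horner p) (- `|B|) `|B|.
- by have := normr_ge0 B; lra.
- apply: subspace_topology.continuous_subspaceT.
  exact: derive.continuous_horner.
exists a => x; have [xB|Bx] := lerP `|x| `|B|.
  by apply: ha; rewrite in_itv /= -ler_norml.
apply: le_trans (ha 0 _) _; first by rewrite in_itv /= oppr_le0 !normr_ge0.
by rewrite -[X in _ <= X]ger0_norm //; apply: hB; have := ler_norm B; lra.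
Qed.

(** Induction on the size: subtracting the minimum [p.[a]] leaves a nonnegative polynomial with root
    [a], thus [('X - a) ^ 2 * q] with [q] nonnegative and smaller. The minimum is itself a
    square. *)
Lemma nneg_poly_sos (R : realType) (p : {poly R}) : (forall x, 0 <= p.[x]) ->
  exists fs : seq {poly R}, p = \sum_(f <- fs) f ^+ 2.
Proof.
have [n] := ubnP (size p); elim: n p => // n IHn p; rewrite ltnS => le_pn p_ge0.
have [a pa_min] := nneg_poly_min p_ge0.
have [||q pE q_ge0] := @nneg_poly_root _ (p - p.[a]%:P) a.
- by move=> x; rewrite !hornerE subr_ge0.
- by rewrite /root !hornerE subrr.
have [fs qE] : exists fs : seq {poly R}, q = \sum_(f <- fs) f ^+ 2.
  have [->|q_neq0] := eqVneq q 0; first by exists [::]; rewrite big_nil.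
  apply: IHn => //; apply: leq_trans le_pn.
  have p_gt1 : (1 < size p)%N.
    rewrite ltnNge; apply/negP => /size1_polyC pC; case/eqP: q_neq0.
    move: pE; rewrite {1 2}pC hornerC subrr => /esym/eqP.
    by rewrite mulf_eq0 expf_eq0 polyXsubC_eq0 => /eqP.
  have <- : size (p - p.[a]%:P) = size p.
    by rewrite size_polyDl // size_polyN (leq_ltn_trans (size_polyC_leq1 _)).
  rewrite pE mulrC size_Mmonic ?monic_exp ?monicXsubC // size_exp_XsubC.
  by rewrite addn3 /=.
exists ((Num.sqrt p.[a])%:P :: [seq ('X - a%:P) * f | f <- fs]).
rewrite big_cons big_map -polyC_exp sqr_sqrtr //.
under eq_bigr do rewrite exprMn.
by rewrite -mulr_sumr -qE -pE addrC subrK.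
Qed.

(** The symmetric second difference [g] at [a] is nonnegative and vanishes at 0, so [g = 'X ^ 2 * q]
    with [q] nonnegative. Comparing second derivatives at 0 gives [p''(a) = q(0)]. *)
Lemma midconvex_poly (R : rcfType) (p : {poly R}) :
  (forall x y, p.[2^-1 * (x + y)] <= 2^-1 * (p.[x] + p.[y])) ->
  forall x, 0 <= p^`(2).[x].
Proof.
move=> p_mid a.
pose g := (p \Po ('X + a%:P)) + (p \Po (a%:P - 'X)) - (2 * p.[a])%:P.
have gE x : g.[x] = p.[x + a] + p.[a - x] - 2 * p.[a].
  by rewrite /g !(hornerE, horner_comp).
have [||q qE q_ge0] := @nneg_poly_root _ g 0.
- move=> x; rewrite gE.
  have := p_mid (x + a) (a - x).
  have -> : 2^-1 * (x + a + (a - x)) = a by field.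
  lra.
- by rewrite /root gE add0r subr0 mulr_natl mulr2n subrr.
have : g^`(2).[0] = 2 * p^`(2).[a].
  rewrite /g !derivnS !derivn0 !(derivE, deriv_comp).
  rewrite !(hornerE, horner_comp) /= !subr0 oppr0; ring.
rewrite qE !derivnS !derivn0 !derivE !hornerE /= => h.
have := q_ge0 0; lra.
Qed.

Lemma poly_convex (R : rcfType) (p : {poly R}) :
  (forall x, 0 <= p^`(2).[x]) ->
  forall t x y, 0 <= t <= 1 ->
  p.[t * x + (1 - t) * y] <= t * p.[x] + (1 - t) * p.[y].
Proof.
rewrite derivnS derivn1 => p2_ge0 t x y /andP[t0 t1].
have p1_homo u v : u <= v -> p^`().[u] <= p^`().[v].
  by move=> uv; apply: (@ler_hornerW _ u v) => //; rewrite in_itv /= lexx uv.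
(* The graph lies above its tangents, by the mean value theorem and the monotonicity of [p']. In the
   average of the tangent bounds at [x] and [y] the slope terms cancel. *)
have tangent c z : p.[c] + p^`().[c] * (z - c) <= p.[z].
  have [zc|cz|->] := ltrgtP z c; last by rewrite subrr mulr0 addr0.
  - have [u /[!in_itv]/= /andP[_ /ltW/p1_homo h] pE] := poly_mvt p zc.
    have : p^`().[u] * (c - z) <= p^`().[c] * (c - z).
      by rewrite ler_wpM2r // subr_ge0 ltW.
    lra.
  - have [u /[!in_itv]/= /andP[/ltW/p1_homo h _] pE] := poly_mvt p cz.
    have : p^`().[c] * (z - c) <= p^`().[u] * (z - c).
      by rewrite ler_wpM2r // subr_ge0 ltW.
    lra.
set c := t * x + (1 - t) * y.
have hx := ler_wpM2l t0 (tangent c x).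
have hy : (1 - t) * (p.[c] + p^`().[c] * (y - c)) <= (1 - t) * p.[y].
  by rewrite ler_wpM2l // subr_ge0.
have -> : p.[c] = t * (p.[c] + p^`().[c] * (x - c))
    + (1 - t) * (p.[c] + p^`().[c] * (y - c)).
  by rewrite /c; ring.
exact: lerD.
Qed.

(** * The Hessian modulo commutators *)

Definition commutator_sum (A : pzRingType) (a : A) :=
  exists fg : seq (A * A), a = \sum_(u <- fg) (u.1 * u.2 - u.2 * u.1).

Section CommutatorSums.
Variables (R : comNzRingType) (A : algType R).
Implicit Types a b : A.

Lemma commutator_sum0 : commutator_sum (0 : A).
Proof. by exists [::]; rewrite big_nil. Qed.

Lemma commutator_sumM a b : commutator_sum (a * b - b * a).
Proof. by exists [:: (a, b)]; rewrite big_seq1. Qed.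

Lemma commutator_sumD a b :
  commutator_sum a -> commutator_sum b -> commutator_sum (a + b).
Proof. by move=> [s ->] [t ->]; exists (s ++ t); rewrite big_cat. Qed.

Lemma commutator_sumZ (c : R) a : commutator_sum a -> commutator_sum (c *: a).
Proof.
move=> [s ->]; exists [seq (c *: u.1, u.2) | u <- s].
rewrite big_map scaler_sumr; apply: eq_bigr => u _ /=.
by rewrite scalerBr scalerAl scalerAr.
Qed.

Lemma commutator_sum_sum (I : Type) (s : seq I) (F : I -> A) :
  (forall i, commutator_sum (F i)) -> commutator_sum (\sum_(i <- s) F i).
Proof.
move=> csF; apply: big_ind => //; first exact: commutator_sum0.
exact: commutator_sumD.
Qed.

(** The variable commutes with everything, so expanding the two products from opposite ends pairs
    [P_i Q_(n-i)] with [Q_(n-i) P_i]. *)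
Lemma commutator_sum_coef (P Q : {poly A}) n :
  commutator_sum (P * Q - Q * P)`_n.
Proof.
rewrite coefB coefM coefMr -sumrB.
by apply: commutator_sum_sum => i; exact: commutator_sumM.
Qed.

End CommutatorSums.

Section Line.
Variables (R : comNzRingType) (A : algType R) (x h : A).
Implicit Types p q : {poly R}.

Lemma commr_line : commr_rmorph (polyC \o in_alg A) (x%:P + h *: 'X).
Proof.
by move=> c /=; apply/polyP => i; rewrite coefCM coefMC mulr_algl mulr_algr.
Qed.

(* The polynomial p(x + t h), with 'X in the role of t. *)
Definition line : {poly R} -> {poly A} := horner_morph commr_line.
HB.instance Definition _ := GRing.RMorphism.on line.

Lemma lineX : line 'X = x%:P + h *: 'X.
Proof. exact: horner_morphX. Qed.

Lemma lineC c : line c%:P = c%:A%:P.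
Proof. exact: horner_morphC. Qed.

Lemma line_coef0 p : (line p)`_0 = horner_alg x p.
Proof.
elim/poly_ind: p => [|p c IHp]; first by rewrite !rmorph0 coef0.
rewrite !rmorphD !rmorphM /= lineX lineC horner_algX horner_algC.
by rewrite coefD coefC coef0M IHp !coefE mulr0 addr0.
Qed.

Lemma line_coef1MXaddC p c :
  (line (p * 'X + c%:P))`_1 = (line p)`_1 * x + horner_alg x p * h.
Proof.
rewrite rmorphD rmorphM /= lineX lineC coefD coefC /= addr0 mulrDr coefD coefMC.
by rewrite -mul_polyC mulrA coefMX coefMC line_coef0.
Qed.

(** Modulo commutators, [d/dt p(x + t h)] acts as [p'(x + t h) h]. The extra factor [q] serves the
    induction: a factor ['X] split off [p] is absorbed by [q]. *)
Lemma deriv_line_mul p q n :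
  commutator_sum ((line p)^`() * line q - line (p^`() * q) * h%:P)`_n.
Proof.
elim/poly_ind: p q n => [|p c IHp] q n.
  by rewrite !(rmorph0, deriv0, mul0r, subr0, coef0); exact: commutator_sum0.
(* By the product rule the term with the differentiated last factor is [line p * h * line q]; one
   cyclic rotation brings [h] to the end. The rest is the induction hypothesis for ['X * q]. *)
have -> : (line (p * 'X + c%:P))^`() * line q
    - line ((p * 'X + c%:P)^`() * q) * h%:P
  = ((line p)^`() * line ('X * q) - line (p^`() * ('X * q)) * h%:P)
    + ((line p * h%:P) * line q - line q * (line p * h%:P)).
  have dL : (x%:P + h *: 'X)^`() = h%:P.
    by rewrite derivD derivC add0r derivZ derivX alg_polyC.
  rewrite derivD derivM derivX derivC mulr1 addr0 mulrDl !(rmorphD, rmorphM) /=.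
  rewrite lineC derivD derivC addr0 derivM lineX dL.
  move: (x%:P + h *: 'X) => L.
  rewrite [line p * line q](_ : _ = line q * line p); last first.
    by rewrite -!rmorphM mulrC.
  rewrite !mulrDl !opprD !mulrA addrACA; congr (_ + _).
by rewrite coefD; apply: commutator_sumD => //; exact: commutator_sum_coef.
Qed.

Lemma deriv2_line p :
  commutator_sum ((line p)^`(2).[0] - (line p^`())`_1 * h).
Proof.
(* The coefficient of [t] in the first derivative is twice the coefficient of [t ^ 2], that is, the
   second derivative at 0. *)
have := deriv_line_mul p 1 1.
rewrite rmorph1 !mulr1 coefB coefMC.
by rewrite horner_coef0 derivnS derivn1 !coef_deriv mulr1n.
Qed.

(* The linear map sending s ^ a t ^ b to x ^ b h x ^ a, where s = 'X and
   t = 'X%:P. *)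
Definition sandwich : {poly {poly R}} -> A :=
  horner_eval x \o map_poly (h \o* horner_alg x).
HB.instance Definition _ := GRing.Additive.on sandwich.

Lemma sandwichC c : sandwich c%:P = horner_alg x c * h.
Proof. by rewrite /sandwich /= map_polyC /= /horner_eval hornerC. Qed.

Lemma sandwichMX g : sandwich (g * 'X) = sandwich g * x.
Proof.
rewrite /sandwich /= /horner_eval -hornerMX; congr horner.
apply/polyP => i; rewrite coefMX !coef_map /= coefMX.
by case: eqP; rewrite // raddf0 mul0r.
Qed.

Lemma sandwichCM c g : sandwich (c%:P * g) = horner_alg x c * sandwich g.
Proof.
elim/poly_ind: g => [|g d IHg]; first by rewrite mulr0 !raddf0 mulr0.
rewrite mulrDr mulrA !raddfD /= !sandwichMX IHg -polyCM !sandwichC.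
by rewrite rmorphM mulrDr !mulrA.
Qed.

(** [g] is the divided difference of [q]. Passing from [q] to [q 'X + c] turns it into [g s + q(t)],
    which [sandwich] matches with the product rule for the part linear in [h]. *)
Lemma line_coef1_sandwich q :
  exists2 g, ('X - 'X%:P) * g = q^:P - q%:P & (line q)`_1 = sandwich g.
Proof.
elim/poly_ind: q => [|q c [g gE lqE]].
  exists 0; first by rewrite map_poly0 polyC0 subrr mulr0.
  by rewrite [line 0]raddf0 coef0 raddf0.
exists (g * 'X + q%:P).
  rewrite mulrDr mulrA gE !rmorphD !rmorphM /= map_polyX map_polyC /=.
  ring.
by rewrite line_coef1MXaddC raddfD /= sandwichMX sandwichC lqE.
Qed.

Variable star : {linear A -> A}.
Hypothesis star1 : star 1 = 1.
Hypothesis starM : forall a b, star (a * b) = star b * star a.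
Hypotheses (starx : star x = x) (starh : star h = h).

Lemma star_horner_alg p : star (horner_alg x p) = horner_alg x p.
Proof.
elim/poly_ind: p => [|p c IHp]; first by rewrite !raddf0.
rewrite rmorphD rmorphM /= horner_algX horner_algC raddfD /= starM IHp starx.
rewrite linearZ /= star1; congr (_ + _).
by transitivity (horner_alg x ('X * p)); [|rewrite mulrC];
   rewrite rmorphM /= horner_algX.
Qed.

(** For [s^a t^b] and [s^c t^d] the product is [x^a h x^(b+d) h x^c], and rotating its initial
    [x^a h] to the end gives [x^(b+d) h x^(a+c) h]. The induction rotates one [x] at a time, and
    finally [h]. *)
Lemma star_sandwichM g1 g2 :
  commutator_sum (star (sandwich g1) * sandwich g2 - sandwich (g1 * g2) * h).
Proof.
elim/poly_ind: g1 g2 => [|g1 c IHg1] g2.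
  rewrite mul0r !raddf0 !mul0r subr0; exact: commutator_sum0.
have -> : star (sandwich (g1 * 'X + c%:P)) * sandwich g2
     - sandwich ((g1 * 'X + c%:P) * g2) * h
  = (star (sandwich g1) * sandwich (g2 * 'X) - sandwich (g1 * (g2 * 'X)) * h)
  + (x * (star (sandwich g1) * sandwich g2)
     - (star (sandwich g1) * sandwich g2) * x)
  + (h * (horner_alg x c * sandwich g2) - (horner_alg x c * sandwich g2) * h).
  have -> : (g1 * 'X + c%:P) * g2 = g1 * (g2 * 'X) + c%:P * g2 by ring.
  move: (g1 * (g2 * 'X)) => g12.
  rewrite !raddfD /= !sandwichMX sandwichC !starM starx starh star_horner_alg.
  rewrite sandwichCM !mulrDl !mulrA opprD.
  set a := sandwich g12 * h; set b := x * _ * _; set d := h * _ * _.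
  set e := _ * h; set k := star _ * _ * x.
  by rewrite addrACA; congr (_ + _); rewrite [RHS]addrC addrA subrK.
apply: commutator_sumD; last exact: commutator_sumM.
by apply: commutator_sumD => //; exact: commutator_sumM.
Qed.

End Line.

(** * Divided differences and the Cauchy matrix *)

Lemma deriv_eq0 (K : numDomainType) (p : {poly {poly {poly K}}}) :
  p^`() = 0 -> p = (p`_0)%:P.
Proof.
move=> dp0; apply/polyP => -[|i]; rewrite coefC //=; apply/eqP.
have /eqP := congr1 (fun q : {poly {poly {poly K}}} => q`_i) dp0.
rewrite coef_deriv coef0 -mulr_natr mulf_eq0 -!polyC_natr !polyC_eq0.
by rewrite pnatr_eq0 orbF.
Qed.

(** Formal integration of [d * F ^ 2] from 0. As [L] is just a ring, the inverses of [n + 1] are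
    supplied by [v]. *)
Lemma deriv_sqr_antiderivative (L : comNzRingType) (F : {poly L})
    (v : nat -> L) (d : L) : (forall n, v n *+ n.+1 = 1) ->
  (\sum_(k < size F) \sum_(l < size F)
     (d * (v (k + l)%N * (F`_k * F`_l)))%:P * 'X^((k + l).+1))^`()
  = d%:P * F ^+ 2.
Proof.
move=> vn; rewrite -[X in _ * X ^+ 2]coefK poly_def expr2 big_distrlr mulr_sumr.
rewrite raddf_sum; apply: eq_bigr => k _.
rewrite mulr_sumr raddf_sum; apply: eq_bigr => l _ /=.
rewrite derivM derivC mul0r add0r derivXn exprD /= -!mul_polyC.
rewrite mulrnAr -mulrnAl -rmorphMn -mulrnAr -mulrnAl vn mul1r /= !polyCM.
ring.
Qed.

Section DividedDifference.
Variable K : numFieldType.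
Local Notation s := ('X : {poly {poly K}}).
Local Notation t := (('X : {poly K})%:P).

(* f(t + u (s - t)), with 'X in the role of u. *)
Definition segment (f : {poly K}) : {poly {poly {poly K}}} :=
  map_poly (polyC \o polyC) f \Po (t%:P + (s - t) *: 'X).

Lemma segment0 f : (segment f).[0] = f%:P.
Proof.
rewrite horner_comp !hornerE ?mulr0 ?addr0 map_poly_comp horner_map /=.
by rewrite -/(comp_poly 'X f) comp_polyXr.
Qed.

Lemma segment1 f : (segment f).[1] = f^:P.
Proof.
rewrite horner_comp hornerD hornerC hornerZ hornerX mulr1 addrC subrK.
rewrite map_poly_comp.
by rewrite -[RHS]comp_polyXr.
Qed.

Lemma deriv_segment f : (segment f)^`() = (s - t)%:P * segment f^`().
Proof.
rewrite deriv_comp deriv_map mulrC derivD derivC add0r derivZ derivX.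
by rewrite alg_polyC.
Qed.

(** The fundamental theorem of calculus in the variable [u]: [W] and [segment q] have the same
    derivative, so they have the same increment from 0 to 1. For [segment q] it is [q(s) - q(t)],
    and [s - t] cancels. *)
Lemma divided_difference_sos (q : {poly K}) (fs : seq {poly K}) g :
  q^`() = \sum_(f <- fs) f ^+ 2 -> (s - t) * g = q^:P - q%:P ->
  g = \sum_(f <- fs) \sum_(k < size (segment f)) \sum_(l < size (segment f))
        ((k + l).+1%:R^-1)%:P%:P * ((segment f)`_k * (segment f)`_l).
Proof.
move=> dq gE.
pose W := \sum_(f <- fs) \sum_(k < size (segment f)) \sum_(l < size (segment f))
  ((s - t) * (((k + l).+1%:R^-1)%:P%:P
              * ((segment f)`_k * (segment f)`_l)))%:P * 'X^((k + l).+1).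
have dW : W^`() = (segment q)^`().
  rewrite deriv_segment dq /segment !rmorph_sum mulr_sumr raddf_sum.
  apply: eq_bigr => f _; rewrite !rmorphXn /= -/(segment f).
  apply: (@deriv_sqr_antiderivative _ _ (fun n => (n.+1%:R^-1)%:P%:P)) => n.
  by rewrite -!rmorphMn -mulr_natr mulVf ?pnatr_eq0.
have /deriv_eq0 WE : (segment q - W)^`() = 0 by rewrite derivB dW subrr.
have W0 : W.[0] = 0.
  rewrite /W !horner_sum big1 // => f _; rewrite horner_sum big1 // => k _.
  by rewrite horner_sum big1 // => l _; rewrite !hornerE expr0n mulr0.
have d_neq0 : s - t != 0 by rewrite polyXsubC_eq0.
apply: (mulfI d_neq0); rewrite gE -segment1 -segment0.
have := congr1 (fun P => P.[1] - P.[0]) WE.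
rewrite /= !hornerE W0 subrr subr0 addrAC => /eqP; rewrite subr_eq0 => /eqP ->.
rewrite /W horner_sum mulr_sumr; apply: eq_bigr => f _.
rewrite horner_sum mulr_sumr; apply: eq_bigr => k _.
rewrite horner_sum mulr_sumr; apply: eq_bigr => l _.
by rewrite hornerM hornerC hornerXn expr1n mulr1.
Qed.

End DividedDifference.

Section CauchySOS.
Variables (R : rcfType) (A : algType R) (star : {linear A -> A}).

Definition hermitian_sos (a : A) :=
  exists r : seq A, a = \sum_(b <- r) star b * b.

Lemma hermitian_sos0 : hermitian_sos 0.
Proof. by exists [::]; rewrite big_nil. Qed.

Lemma hermitian_sosD a b :
  hermitian_sos a -> hermitian_sos b -> hermitian_sos (a + b).
Proof. by move=> [r ->] [u ->]; exists (r ++ u); rewrite big_cat. Qed.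

Lemma hermitian_sosM a : hermitian_sos (star a * a).
Proof. by exists [:: a]; rewrite big_seq1. Qed.

(* The Schur complement of the first pivot of the Cauchy matrix 1/(w_i + w_j)
   is again a Cauchy matrix, with rows and columns rescaled by d_i. *)
Lemma cauchy_hermitian_sos n (w : nat -> R) (c : nat -> A) :
  (forall i, 0 < w i) ->
  hermitian_sos (\sum_(i < n) \sum_(j < n)
    (w i + w j)^-1 *: (star (c i) * c j)).
Proof.
elim: n w c => [|n IHn] w c w_gt0.
  by rewrite big_ord0; exact: hermitian_sos0.
(* Elimination rests on [1/(w_i + w_j) = 2 w_0 / ((w_i + w_0) (w_j + w_0)) + d_i d_j / (w_i + w_j)].
   The first summand has rank one and yields [star r * r]. *)
pose d i := (w i - w 0%N) / (w i + w 0%N).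
pose r := \sum_(i < n.+1) (Num.sqrt (2 * w 0%N) / (w i + w 0%N)) *: c i.
suff -> : \sum_(i < n.+1) \sum_(j < n.+1) (w i + w j)^-1 *: (star (c i) * c j)
  = star r * r + \sum_(i < n) \sum_(j < n) (w i.+1 + w j.+1)^-1 *:
     (star (d i.+1 *: c i.+1) * (d j.+1 *: c j.+1)).
  apply: hermitian_sosD; first exact: hermitian_sosM.
  by apply: (IHn (fun i => w i.+1) (fun i => d i.+1 *: c i.+1)).
have d0 : d 0%N = 0 by rewrite /d subrr mul0r.
(* Since [d 0 = 0], row and column 0 can be put back, and both sides are compared entry by entry. *)
have -> : \sum_(i < n) \sum_(j < n) (w i.+1 + w j.+1)^-1 *:
     (star (d i.+1 *: c i.+1) * (d j.+1 *: c j.+1))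
  = \sum_(i < n.+1) \sum_(j < n.+1) (w i + w j)^-1 *:
     (star (d i *: c i) * (d j *: c j)).
  rewrite [RHS]big_ord_recl [X in _ = X + _]big1 ?add0r => [|j _]; last first.
    by rewrite d0 scale0r linear0 mul0r scaler0.
  apply: eq_bigr => i _.
  rewrite [RHS]big_ord_recl /= d0 scale0r mulr0 scaler0 add0r.
  by apply: eq_bigr => j _.
rewrite /r linear_sum big_distrlr -big_split /=; apply: eq_bigr => i _.
rewrite -big_split /=; apply: eq_bigr => j _.
rewrite !linearZ /= -!scalerAl -!scalerAr !scalerA -scalerDl; congr (_ *: _).
have sqrtE : Num.sqrt (2 * w 0%N) ^+ 2 = 2 * w 0%N.
  by rewrite sqr_sqrtr // mulr_ge0 // ltW.
rewrite mulrACA -expr2 sqrtE /d; have := w_gt0 i; have := w_gt0 j.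
have := w_gt0 0%N => w0 wj wi.
by field; rewrite !lt0r_neq0 ?addr_gt0.
Qed.
End CauchySOS.

Lemma hessian_sos (R : realType) (A : algType R) (x h : A)
    (star : {linear A -> A}) (p : {poly R}) :
  star 1 = 1 -> (forall a b, star (a * b) = star b * star a) ->
  star x = x -> star h = h ->
  (forall y, 0 <= p^`(2).[y]) ->
  exists2 a, hermitian_sos star a
    & commutator_sum ((line x h p)^`(2).[0] - a).
Proof.
move=> star1 starM starx starh /nneg_poly_sos[fs p2E].
have [g gE lE] := line_coef1_sandwich x h p^`().
have gS := divided_difference_sos p2E gE.
pose C f k := sandwich x h (segment f)`_k.
pose S f := \sum_(k < size (segment f)) \sum_(l < size (segment f))
  (k + l).+1%:R^-1 *: (star (C f k) * C f l).
exists (\sum_(f <- fs) S f).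
  apply: big_ind => [|a b|f _]; [exact: hermitian_sos0|exact: hermitian_sosD|].
  (* The Hilbert matrix is the Cauchy matrix of [w_k = k + 1/2]. *)
  have -> : S f = \sum_(k < size (segment f)) \sum_(l < size (segment f))
      ((k%:R + 2^-1) + (l%:R + 2^-1))^-1 *: (star (C f k) * C f l).
    apply: eq_bigr => k _; apply: eq_bigr => l _; congr (_^-1 *: _).
    by rewrite -addn1 !natrD; field.
  apply: (cauchy_hermitian_sos star _ (w := fun k => k%:R + 2^-1)) => k.
  by rewrite ltr_wpDl ?invr_gt0.
(* Two errors, each a sum of commutators: replacing the Hessian by its linearised form times [h],
   and replacing each [sandwich (c_k c_l) * h] by [star C_k * C_l]. *)
have -> : (line x h p)^`(2).[0] - \sum_(f <- fs) S f
  = ((line x h p)^`(2).[0] - (line x h p^`())`_1 * h)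
  + -1 *: \sum_(f <- fs)
      \sum_(k < size (segment f)) \sum_(l < size (segment f))
        (k + l).+1%:R^-1 *: (star (C f k) * C f l
          - sandwich x h ((segment f)`_k * (segment f)`_l) * h).
  rewrite -[RHS]addrA; congr (_ + _).
  rewrite lE gS scaleN1r -opprD; congr (- _).
  rewrite raddf_sum mulr_suml -big_split; apply: eq_bigr => f _ /=.
  rewrite raddf_sum mulr_suml -big_split; apply: eq_bigr => k _ /=.
  rewrite raddf_sum mulr_suml -big_split; apply: eq_bigr => l _ /=.
  by rewrite sandwichCM horner_algC mulr_algl -scalerAl -scalerDr addrC subrK.
apply: commutator_sumD; first exact: deriv2_line.
apply: commutator_sumZ; do 3!apply: commutator_sum_sum => ?.
by apply: commutator_sumZ; exact: star_sandwichM.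
Qed.

(** * The free algebra and its matrix evaluations *)

Section MonoidAlgebra.
Variables (K : monomType) (R : comNzRingType).

Lemma malgUM (a b : R) (k l : K) :
  << a *g k >> * << b *g l >> = << a * b *g mmul k l >>.
Proof. by rewrite malgM_def fgmulUU. Qed.

Lemma malgUZ (c a : R) (k : K) : c *: << a *g k >> = << c * a *g k >>.
Proof. by rewrite -mul_malgC malgUM mul1m. Qed.

Lemma malg_ind (P : {malg R[K]} -> Prop) :
  (forall f g, P f -> P g -> P (f + g)) -> (forall a k, P << a *g k >>) ->
  forall f, P f.
Proof.
move=> PD PU f; rewrite (monalgE f); apply: (big_ind P) => //.
by rewrite -(monalgU0 (mone : K)).
Qed.

(** This axiom makes [free_algebra] an algebra; it rests on the commutativity of [R], not of the
    monoid. *)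
Lemma malg_scalerAr (c : R) (f g : {malg R[K]}) : c *: (f * g) = f * (c *: g).
Proof.
elim/malg_ind: f => [f1 f2 IH1 IH2|a k].
  by rewrite !mulrDl scalerDr IH1 IH2.
elim/malg_ind: g => [g1 g2 IH1 IH2|b l].
  by rewrite mulrDr !scalerDr mulrDr IH1 IH2.
by rewrite malgUZ !malgUM malgUZ mulrCA.
Qed.

End MonoidAlgebra.

Section FreeAlgebra.
Variable R : realType.
Implicit Types f g : free_xh R.

(* An alias is needed because the algebra instances of malg already declared
   are keyed on commutative monoids. *)
Definition free_algebra : Type := free_xh R.
HB.instance Definition _ := GRing.Lalgebra.copy free_algebra (free_xh R).
HB.instance Definition _ :=
  GRing.Lalgebra_isAlgebra.Build R free_algebra (@malg_scalerAr _ R).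

(** Linearity compares elements with different supports; this lets all sums range over one common
    finite set. *)
Lemma involutionEw (d : {fset {fmonom bool}}) f : (msupp f `<=` d)%fset ->
  involution f = \sum_(w <- d) << f@_w *g FMonom (rev w) >>.
Proof.
move=> le; rewrite /involution [LHS](big_fset_incl _ le) => //= w _ wf.
by rewrite mcoeff_outdom // monalgU0.
Qed.

Lemma involutionU (c : R) (w : {fmonom bool}) :
  involution << c *g w >> = << c *g FMonom (rev w) >>.
Proof. by rewrite (involutionEw msuppU_le) big_seq_fset1 mcoeffUU. Qed.

Lemma involution_linear : linear (@involution R).
Proof.
move=> c f g; rewrite !(involutionEw (d := (msupp f `|` msupp g)%fset)).
- rewrite scaler_sumr -big_split; apply: eq_bigr => w _ /=.
  by rewrite mcoeffD mcoeffZ monalgUD malgUZ.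
- exact: fsubsetUr.
- exact: fsubsetUl.
- apply: fsubset_trans (msuppD_le _ _) _; apply: fsetSU; exact: msuppZ_le.
Qed.

HB.instance Definition _ :=
  GRing.isLinear.Build R (free_xh R) (free_xh R) _ (@involution R)
    involution_linear.

Lemma involutionM f g : involution (f * g) = involution g * involution f.
Proof.
elim/malg_ind: f => [f1 f2 IH1 IH2|a v].
  by rewrite mulrDl !raddfD /= mulrDr IH1 IH2.
elim/malg_ind: g => [g1 g2 IH1 IH2|b w].
  by rewrite mulrDr !raddfD /= mulrDl IH1 IH2.
rewrite malgUM !involutionU malgUM mulrC; congr << _ *g _ >>.
by rewrite /mmul /= !fmmulE rev_cat.
Qed.

Lemma involution_gen (b : bool) :
  involution << fmu b >> = << fmu b >> :> free_xh R.
Proof. by rewrite involutionU fmuE. Qed.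

Lemma involution1 : involution 1 = 1 :> free_xh R.
Proof. by rewrite [LHS]involutionU /mone /= fmoneE /= -fmoneE. Qed.

Lemma nc_lineE (p : {poly R}) : nc_line p = @line R free_algebra ncx nch p.
Proof.
have cE (c : R) : c%:MP%:P = (polyC \o in_alg free_algebra) c.
  by rewrite /= -mul_malgC mulr1.
by rewrite /nc_line /line /horner_morph (eq_map_poly cE).
Qed.

Lemma free_hessian_sos (p : {poly R}) : (forall y, 0 <= p^`(2).[y]) ->
  sum_hermitian_squares_commutators (nc_hessian p).
Proof.
move=> p2_ge0; have [] := @hessian_sos R free_algebra ncx nch (@involution R) p.
- exact: involution1.
- exact: involutionM.
- exact: involution_gen.
- exact: involution_gen.
- exact: p2_ge0.
move=> a [r aE] [fg hE]; exists r, fg.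
by rewrite -aE -hE addrC subrK /nc_hessian nc_lineE.
Qed.

End FreeAlgebra.

Lemma poly_horner_inj (R : numDomainType) (p q : {poly R}) :
  (forall x, p.[x] = q.[x]) -> p = q.
Proof.
move=> pq; apply/eqP; rewrite -subr_eq0; apply/eqP.
apply: (@roots_geq_poly_eq0 _ _ [seq i%:R | i <- iota 0 (size (p - q))]).
- by apply/allP => x _; rewrite /root !hornerE pq subrr.
- rewrite map_inj_uniq ?iota_uniq // => i j /eqP.
  by rewrite eqr_nat => /eqP.
- by rewrite size_map size_iota.
Qed.

Lemma line_horner (R : comNzRingType) (A : algType R) (x h : A) p (t : R) :
  (line x h p).[t%:A] = horner_alg (x + t *: h) p.
Proof.
elim/poly_ind: p => [|p c IHp]; first by rewrite !rmorph0 horner0.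
rewrite !rmorphD !rmorphM /= lineX lineC horner_algX horner_algC.
(* Over a noncommutative ring, evaluation respects this product because the scalar point [t%:A] is
   central. *)
rewrite hornerD hornerC; congr (_ + _); rewrite hornerM_comm; last first.
  by rewrite /comm_poly mulr_algl mulr_algr.
by rewrite IHp hornerD hornerC hornerZ hornerX mulr_algr.
Qed.

Lemma map_line (R : comNzRingType) (A B : algType R) (phi : {lrmorphism A -> B})
    (x h : A) p : map_poly phi (line x h p) = line (phi x) (phi h) p.
Proof.
elim/poly_ind: p => [|p c IHp]; first by rewrite !rmorph0.
rewrite !(rmorphD, rmorphM) /= IHp !lineX !lineC map_polyC /=.
by rewrite rmorphD /= map_polyC map_polyZ map_polyX linearZ rmorph1.
Qed.

Lemma map_poly_linear_horner (R : comNzRingType) (A : algType R)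
    (f : {linear A -> R^o}) (P : {poly A}) (t : R) :
  (map_poly f P).[t] = f P.[t%:A].
Proof.
have le : (size (map_poly f P) <= size P)%N by exact: size_poly.
rewrite (horner_coef_wide t le) horner_coef linear_sum.
apply: eq_bigr => i _; rewrite coef_map /= exprZn expr1n.
by rewrite mulr_algr linearZ /= mulrC.
Qed.

Lemma deriv2_horner0 (A : nzRingType) (P : {poly A}) : P^`(2).[0] = P`_2 *+ 2.
Proof. by rewrite horner_coef0 coef_derivn. Qed.

Section Evaluation.
Variables (R : realType) (A : algType R) (a b : A).

Definition word_eval (w : {fmonom bool}) : A :=
  \prod_(c <- w) (if c then b else a).

Lemma word_eval_mmorphism : mmorphism word_eval.
Proof.
split=> [v w|]; rewrite /word_eval /mone /mmul /=.
  by rewrite fmmulE big_cat.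
by rewrite fmoneE big_nil.
Qed.
HB.instance Definition _ :=
  isMultiplicative.Build {fmonom bool} A word_eval word_eval_mmorphism.

Definition free_eval : free_algebra R -> A := mmap (in_alg A) word_eval.
HB.instance Definition _ :=
  GRing.Additive.copy free_eval (mmap (in_alg A) word_eval).

Lemma free_evalU c w : free_eval << c *g w >> = c *: word_eval w.
Proof. by rewrite /free_eval mmapU /= mulr_algl. Qed.

Lemma free_eval_multiplicative : multiplicative free_eval.
Proof.
apply: commr_mmap_is_multiplicative => g m w.
by rewrite /GRing.comm /= mulr_algl mulr_algr.
Qed.
HB.instance Definition _ :=
  GRing.isMultiplicative.Build (free_algebra R) A free_eval
    free_eval_multiplicative.

Lemma free_eval_scalable : scalable free_eval.
Proof. by move=> c f; rewrite /free_eval mmapZ /= mulr_algl. Qed.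
HB.instance Definition _ :=
  GRing.isScalable.Build R (free_algebra R) A _ free_eval free_eval_scalable.

Lemma free_eval_ncx : free_eval ncx = a.
Proof. by rewrite free_evalU fmuE /word_eval big_seq1 scale1r. Qed.

Lemma free_eval_nch : free_eval nch = b.
Proof. by rewrite free_evalU fmuE /word_eval big_seq1 scale1r. Qed.

Lemma free_eval_hessian p : free_eval (nc_hessian p) = (line a b p)^`(2).[0].
Proof.
rewrite /nc_hessian nc_lineE !deriv2_horner0 raddfMn -coef_map /= map_line /=.
by rewrite free_eval_ncx free_eval_nch.
Qed.
End Evaluation.

Section MatrixEvaluation.
Variables (R : realType) (n : nat).
Implicit Types X H Y : 'M[R]_n.+1.

Lemma free_eval_involution X H f : X^T = X -> H^T = H ->
  free_eval X H (involution f) = (free_eval X H f)^T.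
Proof.
move=> XT HT; elim/malg_ind: f => [f g IHf IHg|c w].
  by rewrite !raddfD /= IHf IHg.
rewrite involutionU !free_evalU linearZ /=; congr (_ *: _).
case: w => w; rewrite /word_eval /=; elim: w => [|d w IHw].
  by rewrite !big_nil trmx1.
rewrite rev_cons big_rcons big_cons /= IHw -!mulmxE trmx_mul.
by case: d; rewrite ?XT ?HT.
Qed.

Lemma mxtrace_sqr_ge0 X : 0 <= \tr (X^T * X).
Proof.
apply: sumr_ge0 => i _; rewrite mxE; apply: sumr_ge0 => j _.
by rewrite mxE -expr2 sqr_ge0.
Qed.

(** Evaluation at [X] and [H] turns hermitian squares into matrices [M^T M], of nonnegative trace,
    and commutators into matrices of trace 0. *)
Lemma mxtrace_hessian_ge0 X H p : X^T = X -> H^T = H ->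
  sum_hermitian_squares_commutators (nc_hessian p) ->
  0 <= \tr ((line X H p)^`(2).[0]).
Proof.
move=> XT HT [r [fg hE]].
have -> : \tr (line X H p)^`(2).[0]
    = \sum_(f <- r) \tr (free_eval X H (involution f * f)).
  rewrite -free_eval_hessian hE raddfD !raddf_sum mxtraceD !raddf_sum /=.
  rewrite [X in _ + X]big1 ?addr0 // => u _.
  by rewrite rmorphB !rmorphM raddfB /= -!mulmxE mxtrace_mulC subrr.
apply: sumr_ge0 => f _.
by rewrite rmorphM /= free_eval_involution // mxtrace_sqr_ge0.
Qed.

Lemma horner_mx_alg X p : horner_mx X p = horner_alg X p.
Proof.
rewrite /horner_mx /horner_alg /horner_morph; congr (_.[_]).
by apply: eq_map_poly => c; rewrite /= scalemx1.
Qed.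

(** A genuine real polynomial in [t], so that the univariate results apply to the trace along a line
    of matrices. *)
Definition trace_line X H p : {poly R} :=
  map_poly (@mxtrace R n.+1) (line X H p).

Lemma trace_line_horner X H p t :
  (trace_line X H p).[t] = \tr (horner_mx (X + t *: H) p).
Proof.
rewrite horner_mx_alg -line_horner.
exact: (map_poly_linear_horner (@mxtrace R n.+1)).
Qed.

Lemma trace_line_shift X H p t :
  trace_line X H p \Po ('X + t%:P) = trace_line (X + t *: H) H p.
Proof.
apply: poly_horner_inj => u; rewrite horner_comp !trace_line_horner !hornerE.
by rewrite scalerDl addrA [X in horner_mx X]addrAC.
Qed.

Lemma trace_line_deriv2_ge0 X H p t : X^T = X -> H^T = H ->
  sum_hermitian_squares_commutators (nc_hessian p) ->
  0 <= (trace_line X H p)^`(2).[t].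
Proof.
move=> XT HT hp.
(* The Hessian controls the second derivative at parameter 0 only; moving the base point to
   [X + t *: H] reaches every [t]. *)
have -> : (trace_line X H p)^`(2).[t]
    = (trace_line X H p \Po ('X + t%:P))^`(2).[0].
  rewrite !derivnS !derivn0 !(deriv_comp, derivE) addr0 !mulr1.
  by rewrite !(horner_comp, hornerE).
rewrite trace_line_shift deriv2_horner0 coef_map /= -raddfMn -deriv2_horner0.
by apply: mxtrace_hessian_ge0 => //; rewrite linearD linearZ /= XT HT.
Qed.
End MatrixEvaluation.

(** * Trace convexity and the equivalence *)

Lemma sos_trace_convex (R : realType) (p : {poly R}) :
  sum_hermitian_squares_commutators (nc_hessian p) -> trace_convex p.
Proof.
move=> hp n X Y XT YT.
have dT : (Y - X)^T = Y - X by rewrite linearB /= XT YT.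
(* The line through [X] in direction [Y - X] reaches [Y] at parameter 1 and the midpoint at
   [2^-1]. *)
have := poly_convex (fun t => trace_line_deriv2_ge0 t XT dT hp) (t := 2^-1) 0 1.
rewrite !trace_line_horner scale0r addr0 scale1r [X + (Y - X)]addrC subrK.
rewrite mulr0 mulr1 add0r.
have half : 1 - 2^-1 = 2^-1 :> R by field.
rewrite half.
have -> : X + 2^-1 *: (Y - X) = 2^-1 *: (X + Y).
  rewrite scalerBr addrCA -{1}[X]scale1r -scalerBl half.
  by rewrite -scalerDr [Y + X]addrC.
by rewrite -mulrDr; apply; lra.
Qed.

Lemma trace_convex_deriv2_ge0 (R : realType) (p : {poly R}) :
  trace_convex p -> forall x, 0 <= p^`(2).[x].
Proof.
move=> hp; apply: midconvex_poly => x y.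
have trE z : \tr (horner_mx (z%:M : 'M_1) p) = p.[z].
  by rewrite -diag_const_mx horner_mx_diag mxtrace_diag big_ord1 !mxE.
(* Index 0 means size 1, where the trace inequality is midpoint convexity of [p]. *)
have := hp 0%N x%:M y%:M (tr_scalar_mx _ _) (tr_scalar_mx _ _).
by rewrite -raddfD /= scale_scalar_mx !trE.
Qed.

Unset Implicit Arguments.

Theorem theorem3p1 (R : realType) (p : {poly R}) :
  [<-> convex_function (E := R^o) [set: R^o]%classic (fun a : R => p.[a]);
       trace_convex p;
       sum_hermitian_squares_commutators (nc_hessian p)].
Proof.
tfae.
(* Convexity yields trace convexity by way of the certificate, and needs to be applied at weight
   [2^-1] only. *)
- move=> p_conv; apply/sos_trace_convex/free_hessian_sos/midconvex_poly => x y.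
  have half_ge0 : 0 <= 2^-1 :> R by lra.
  have half_le1 : 2^-1 <= 1 :> R by lra.
  have : p.[2^-1 * x + (1 - 2^-1) * y] <= 2^-1 * p.[x] + (1 - 2^-1) * p.[y].
    exact: (p_conv (Itv01 half_ge0 half_le1) x y (mem_set I) (mem_set I)).
  have -> : 1 - 2^-1 = 2^-1 :> R by field.
  by rewrite -!mulrDr.
- by move=> /trace_convex_deriv2_ge0/free_hessian_sos.
- move=> /sos_trace_convex/trace_convex_deriv2_ge0/poly_convex p_conv t x y _ _.
  by apply: p_conv; rewrite ge0 le1.
Qed.
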